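(* Let $n\geq 2$, let $U$ be a unitary on a Hilbert space $H$, and let $(P,S)\in B(H)^2$ be a $U$-commuting pair with $P^n=P$. Then: (a) $PS=U^{n-1}PS$. (b) Let $H_0$ be the maximal closed subspace of $\ker PS$ that reduces both $P$ and $S$, and write $U=U_0\oplus U_1$ with respect to $H=H_0\oplus(H\ominus H_0)$. Then $U_1^{n-1}=I$. Moreover $U_0$ can be replaced by the identity, so that the pair $(P,S)$ has a twist $\tilde U=I\oplus U_1$ satisfying $\tilde U^{n-1}=I$; the spectrum of this twist is a pure point spectrum consisting of $(n-1)$-th roots of $1$. In particular: (c) If $P$ is idempotent ($P^2=P$) and $(P,S)$ is twisted commuting, then $PS=SP$. In particular, orthogonal projections are never members of a twisted commuting pair that is not commuting. (d) If $P^3=P$ and $(P,S)$ is twisted commuting, then $H$ decomposes as an orthogonal sum of two subspaces reducing $P$ and $S$, such that $P$ and $S$ commute on one of them and anti-commute ($PS=-SP$) on the other.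
   Context: A pair $(S,T)$ of bounded operators on $H$ is $U$-commuting, for a unitary $U$ on $H$, if $U$ commutes with $S$ and $T$ and $ST=UTS$; then $U$ is called a twist of the pair. A pair is twisted commuting if it is $U$-commuting for some unitary $U$. An operator $P$ is called $n$-potent if $P^n=P$. $H_0$ automatically reduces every twist of the pair. *)

(* Defs.v *)
From mathcomp Require Import all_boot all_order all_algebra.
From mathcomp Require Import complex.
From mathcomp Require Import all_classical all_reals all_analysis.

Set Implicit Arguments.
Unset Strict Implicit.
Unset Printing Implicit Defensive.

Import Order.TTheory GRing.Theory Num.Theory.
Import numFieldNormedType.Exports.

Local Open Scope classical_set_scope.
Local Open Scope complex_scope.
Local Open Scope ring_scope.

(* Complex Hilbert spaces, of arbitrary dimension. The inner product is linear
   in its first argument; norms are values of R[i], whose order makes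
   0 <= z mean that z is real and nonnegative. *)
Record hilbertSpace (R : realType) := HilbertSpace {
  hilbert_sort :> completeNormedModType R[i];
  inner : {dot hilbert_sort for @conjc R};
  innerE : forall x : hilbert_sort, inner x x = `|x| ^+ 2
}.

Arguments inner {R} h.

Record boundedOp (R : realType) (H : hilbertSpace R) := BoundedOp {
  op_linear :> {linear H -> H};
  op_bounded : exists M : R[i], forall x : H, `|op_linear x| <= M * `|x|
}.

Definition is_adjoint (R : realType) (H : hilbertSpace R)
    (T T' : boundedOp H) : Prop :=
  forall x y : H, inner H (T x) y = inner H x (T' y).

Definition unitary (R : realType) (H : hilbertSpace R) (U : boundedOp H) :
    Prop :=
  exists V : boundedOp H,
    [/\ is_adjoint U V, V \o U =1 id & U \o V =1 id].

Definition orthogonal_projection (R : realType) (H : hilbertSpace R)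
    (Q : boundedOp H) : Prop :=
  Q \o Q =1 Q /\ is_adjoint Q Q.

(* (S, T) is U-commuting, i.e. U is a twist of (S, T) *)
Definition is_twist (R : realType) (H : hilbertSpace R)
    (U S T : boundedOp H) : Prop :=
  [/\ unitary U, U \o S =1 S \o U, U \o T =1 T \o U &
      S \o T =1 U \o T \o S].

Definition twisted_commuting (R : realType) (H : hilbertSpace R)
    (S T : boundedOp H) : Prop :=
  exists U : boundedOp H, is_twist U S T.

Definition n_potent (R : realType) (H : hilbertSpace R) (n : nat)
    (P : boundedOp H) : Prop :=
  iter n P =1 P.

Definition closed_subspace (R : realType) (H : hilbertSpace R) (M : set H) :
    Prop :=
  [/\ M 0, forall (a : R[i]) (x y : H), M x -> M y -> M (a *: x + y) &
      closed M].

Definition orthocomp (R : realType) (H : hilbertSpace R) (M : set H) :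
    set H :=
  [set y | forall x, M x -> inner H x y = 0].

Definition reduces (R : realType) (H : hilbertSpace R) (M : set H)
    (T : boundedOp H) : Prop :=
  [/\ closed_subspace M, forall x, M x -> M (T x) &
      forall y, orthocomp M y -> orthocomp M (T y)].

Definition reducing_in_ker (R : realType) (H : hilbertSpace R)
    (P S : boundedOp H) (M : set H) : Prop :=
  [/\ reduces M P, reduces M S & forall x, M x -> P (S x) = 0].

(* maximal with respect to inclusion, in the sense of greatest element *)
Definition max_reducing_in_ker (R : realType) (H : hilbertSpace R)
    (P S : boundedOp H) (M : set H) : Prop :=
  reducing_in_ker P S M /\
  forall N : set H, reducing_in_ker P S N -> N `<=` M.

(* T = A (+) B with respect to H = M (+) (H (-) M). An operator on a subspace
   is represented by a function on H of which only the restriction to that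
   subspace is used. *)
Definition direct_sum_op (R : realType) (H : hilbertSpace R) (M : set H)
    (A B : H -> H) (T : boundedOp H) : Prop :=
  [/\ forall x, M x -> M (A x),
      forall y, orthocomp M y -> orthocomp M (B y) &
      forall x y, M x -> orthocomp M y -> T (x + y) = A x + B y].

Definition orthogonal_sum (R : realType) (H : hilbertSpace R)
    (M N : set H) : Prop :=
  (forall x y, M x -> N y -> inner H x y = 0) /\
  (forall z : H, exists x y, [/\ M x, N y & z = x + y]).

Definition spectrum (R : realType) (H : hilbertSpace R) (T : boundedOp H) :
    set R[i] :=
  [set l | ~ exists V : boundedOp H, forall x : H,
     V (T x - l *: x) = x /\ T (V x) - l *: V x = x].

Definition eigenvector (R : realType) (H : hilbertSpace R)
    (T : boundedOp H) (l : R[i]) (x : H) : Prop :=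
  x <> 0 /\ T x = l *: x.

Definition point_spectrum (R : realType) (H : hilbertSpace R)
    (T : boundedOp H) : set R[i] :=
  [set l | exists x : H, eigenvector T l x].

(* Every point of the spectrum is an eigenvalue, and the eigenvectors span a
   dense subspace: there is no continuous part. *)
Definition pure_point_spectrum (R : realType) (H : hilbertSpace R)
    (T : boundedOp H) : Prop :=
  spectrum T = point_spectrum T /\
  (forall M : set H, closed_subspace M ->
     (forall l x, eigenvector T l x -> M x) -> M = setT).

(* Main.v *)
Require Import Defs.
From HB Require Import structures.
From mathcomp Require Import all_boot all_order all_algebra.
From mathcomp Require Import complex.
From mathcomp Require Import all_classical all_reals all_analysis.
From mathcomp Require Import ring lra.
From mathcomp Require Import separable cyclotomic.
Import Order.TTheory GRing.Theory Num.Theory.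
Import numFieldNormedType.Exports.

Local Open Scope classical_set_scope.
Local Open Scope complex_scope.
Local Open Scope ring_scope.

Set Implicit Arguments.
Unset Strict Implicit.
Unset Printing Implicit Defensive.

(** Moving P across S k times turns the twist relation into
    P^k S = U^k S P^k, because U commutes with P and S
    ([twist_iter]).  For k = n and P^n = P this reads
    P S = U^n S P = U^(n-1) (U S P) = U^(n-1) P S, so U^(n-1) fixes the range
    of P S ([npotent_twist_fixes]).

    Put W = U^(n-1).  The operator W - 1 commutes with P and S and kills the
    range of P S, hence P S kills the range of W - 1.  The closed span of this
    range is invariant under P and S, and so is its orthocomplement, which is
    the fixed space of W since W is unitary.  It is therefore a reducing
    subspace inside ker P S, so it lies in the maximal one, H0; taking
    orthocomplements, W fixes every vector of the orthocomplement of H0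
    ([fixes_range_fixes_orthocomp]).  On H0 both P S and S P vanish, so
    nothing constrains the twist there: replacing U by the identity on H0
    gives a twist whose (n-1)-st power is 1 ([id_on_max_reducing_twist]).
    Defining this operator on all of H requires H = H0 + H0^perp, that is, the
    projection theorem, which is proved from completeness and the
    parallelogram law.

    An operator T with T^m = 1 is annihilated by X^m - 1, a product of
    distinct linear factors.  Euclidean division by X - l turns this into an
    explicit inverse of T - l for every l that is not an eigenvalue
    ([annihilated_resolvent]), and writes every vector as a sum of
    eigenvectors ([annihilated_in_eigenspan]); hence the pure point spectrum.

    For n = 2 the first paragraph gives U P S = P S = U S P, and U is
    injective.  For n = 3 the modified twist is a self-adjoint unitary, whose
    eigenspaces for 1 and -1 are the two summands on which P and S commute
    and anti-commute. *)

(** * Inner product and real norm *)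

Section InnerProduct.
Context {R : realType} {H : hilbertSpace R}.
Implicit Types (x y z : H) (a : R[i]).
Local Notation ip := (inner H).

Lemma innerC x y : ip y x = (ip x y)^*.
Proof. by rewrite (hermC (inner H)) expr0 mul1r. Qed.

Lemma innerDl x y z : ip (x + y) z = ip x z + ip y z.
Proof. exact: linearDl. Qed.

Lemma innerDr x y z : ip z (x + y) = ip z x + ip z y.
Proof. exact: linearDr. Qed.

Lemma innerZl a x y : ip (a *: x) y = a * ip x y.
Proof. exact: linearZl_LR. Qed.

Lemma innerZr a x y : ip x (a *: y) = a^* * ip x y.
Proof. exact: linearZr_LR. Qed.

Lemma inner0r x : ip x 0 = 0.
Proof. exact: linear0r. Qed.

Lemma innerNl x y : ip (- x) y = - ip x y.
Proof. exact: linearNl. Qed.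

Lemma innerNr x y : ip x (- y) = - ip x y.
Proof. exact: linearNr. Qed.

Lemma innerBl x y z : ip (x - y) z = ip x z - ip y z.
Proof. by rewrite innerDl innerNl. Qed.

Lemma innerBr x y z : ip z (x - y) = ip z x - ip z y.
Proof. by rewrite innerDr innerNr. Qed.

Lemma inner_eq0C x y : ip x y = 0 -> ip y x = 0.
Proof. by move=> xy; rewrite innerC xy rmorph0. Qed.

Lemma inner_eq0 x : ip x x = 0 -> x = 0.
Proof. by rewrite innerE => /eqP; rewrite sqrf_eq0 normr_eq0 => /eqP. Qed.

(** The norm takes values in R[i], whose order is partial; infima and real
    inequalities need it as an element of R. *)
Definition rnorm x : R := complex.Re `|x|.

Lemma rnormE x : `|x| = (rnorm x)%:C.
Proof. by rewrite /rnorm RRe_real // ger0_real. Qed.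

Lemma rnorm_ge0 x : 0 <= rnorm x.
Proof. by rewrite -ler0c -rnormE. Qed.

Lemma inner_rnorm x : ip x x = (rnorm x ^+ 2)%:C.
Proof. by rewrite innerE rnormE rmorphXn. Qed.

Lemma rnormB x y : rnorm (x - y) = rnorm (y - x).
Proof. by apply: complexI; rewrite -!rnormE distrC. Qed.

Lemma rnormD x y : rnorm (x + y) <= rnorm x + rnorm y.
Proof. by rewrite -lecR rmorphD /= -!rnormE ler_normD. Qed.

Lemma parallelogram x y :
  rnorm (x + y) ^+ 2 + rnorm (x - y) ^+ 2 = 2 * (rnorm x ^+ 2 + rnorm y ^+ 2).
Proof.
apply: complexI; rewrite mulr_natl rmorphMn !rmorphD /= -!inner_rnorm.
rewrite innerBl !innerDl !innerBr !innerDr; ring.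
Qed.

Lemma pythagoras x y :
  ip x y = 0 -> rnorm (x + y) ^+ 2 = rnorm x ^+ 2 + rnorm y ^+ 2.
Proof.
move=> xy; apply: complexI; rewrite rmorphD /= -!inner_rnorm.
by rewrite innerDl !innerDr xy (inner_eq0C xy) addr0 add0r.
Qed.

(** Removing from x its component along y leaves a vector orthogonal to y.
    Nonnegativity of its square norm is the Cauchy-Schwarz inequality, and the
    loss of square norm is what forces orthogonality in the projection
    theorem. *)
Lemma inner_residual x y (r := x - (ip x y / ip y y) *: y) : y <> 0 ->
  ip r y = 0 /\ ip r r = ip x x - `|ip x y| ^+ 2 / ip y y.
Proof.
move=> y0; have yy0 : ip y y != 0 by apply/eqP => /inner_eq0.
have ry : ip r y = 0 by rewrite innerBl innerZl divfK ?subrr.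
split=> //; rewrite {2}/r innerBr innerZr ry mulr0 subr0 innerBl innerZl.
by rewrite mulrAC [ip y x]innerC -sqr_normc.
Qed.

Lemma cauchy_schwarz x y : `|ip x y| <= `|x| * `|y|.
Proof.
have [->|/eqP y0] := eqVneq y 0; first by rewrite inner0r !normr0 mulr0.
rewrite -ler_sqr ?nnegrE ?mulr_ge0 // exprMn -!innerE.
have yy_gt0 : 0 < ip y y by rewrite innerE exprn_gt0 // normr_gt0; apply/eqP.
rewrite -ler_pdivrMr // -subr_ge0; have [_ <-] := inner_residual x y0.
by rewrite innerE exprn_ge0.
Qed.

Lemma closed_rnormP (M : set H) :
  closed M <-> forall x, (forall e : R, 0 < e -> exists2 m, M m & rnorm (x - m) < e) -> M x.
Proof.
split=> [cM x xM|cM x xM].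
  apply: cM => B /nbhs_ballP[e /= e0 eB].
  have e0' : 0 < complex.Re e by rewrite -ltcR RRe_real // gtr0_real.
  have [m Mm me] := xM _ e0'.
  exists m; split => //; apply: eB; rewrite -ball_normE /= rnormE.
  by rewrite -[e]RRe_real ?gtr0_real // ltcR.
apply: cM => e e0.
have e0' : 0 < e%:C by rewrite ltcR.
have [m [Mm]] := xM _ (nbhsx_ballx x _ e0').
by rewrite -ball_normE /= rnormE ltcR => ?; exists m.
Qed.
End InnerProduct.

(** * The projection theorem *)

Section Projection.
Context {R : realType} {H : hilbertSpace R}.
Implicit Types (x y z m : H) (M : set H).
Local Notation ip := (inner H).

Lemma subspaceB M x y : closed_subspace M -> M x -> M y -> M (x - y).
Proof.
by case=> M0 MD _ Mx My; rewrite addrC -scaleN1r; apply: MD.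
Qed.

Lemma subspaceZ M (a : R[i]) x : closed_subspace M -> M x -> M (a *: x).
Proof. by case=> M0 MD _ Mx; rewrite -[a *: x]addr0; apply: MD. Qed.

Lemma subspaceD M x y : closed_subspace M -> M x -> M y -> M (x + y).
Proof. by case=> M0 MD _ Mx My; rewrite -[x]scale1r; apply: MD. Qed.

Lemma orthocomp_closed_subspace M : closed_subspace (orthocomp M).
Proof.
split=> [x _|a y z yM zM x Mx|].
- by rewrite inner0r.
- by rewrite innerDr innerZr (yM _ Mx) (zM _ Mx) mulr0 addr0.
apply/closed_rnormP => y yM x Mx; apply/eqP; rewrite -normr_eq0.
apply: contraT => xy0; pose c := complex.Re `|ip x y|.
have cE : `|ip x y| = c%:C by rewrite RRe_real // ger0_real.
have c_gt0 : 0 < c by rewrite -ltcR -cE lt_neqAle eq_sym xy0 normr_ge0.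
have x0 := rnorm_ge0 x.
have e_gt0 : 0 < c / (rnorm x + 1) by apply: divr_gt0 => //; clear -x0; lra.
have [n nM yn] := yM _ e_gt0.
have : c <= rnorm x * rnorm (y - n).
  rewrite -lecR rmorphM /= -!rnormE -cE.
  by have := cauchy_schwarz x (y - n); rewrite innerBr (nM _ Mx) subr0.
have : c / (rnorm x + 1) * (rnorm x + 1) = c by rewrite divfK //; clear -x0; lra.
move: yn; set e := c / _; have n0 := rnorm_ge0 (y - n) => yn eE le_c.
by exfalso; clear -eE le_c yn x0 n0 c_gt0; nra.
Qed.

(** The sets of almost-nearest points of M to x shrink as e tends to 0; they
    form the base of the Cauchy filter whose limit is the nearest point. *)
Definition near_min M x (e : R) : set H :=
  let d := inf [set rnorm (x - m) ^+ 2 | m in M] in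
  [set m | M m /\ rnorm (x - m) ^+ 2 < d + e].

Section Minimizer.
Context {M : set H} (cM : closed_subspace M) (x : H).
Let D := [set rnorm (x - m) ^+ 2 | m in M].
Let d := inf D.

Let dist_has_inf : has_inf D.
Proof.
split; first by case: cM => M0 _ _; exists (rnorm (x - 0) ^+ 2), 0.
by exists 0 => _ [m _ <-]; rewrite sqr_ge0.
Qed.

Let dist_min m : M m -> d <= rnorm (x - m) ^+ 2.
Proof. by move=> Mm; apply: ge_inf; [case: dist_has_inf|exists m]. Qed.

Let near_min_neq0 (e : R) : 0 < e -> near_min M x e !=set0.
Proof.
by move=> e0; have [_ [m Mm <-] ?] := inf_adherent e0 dist_has_inf; exists m.
Qed.

(* The midpoint of m and n lies in M, hence at distance at least sqrt d from x;
   the parallelogram law then leaves little room between m and n. *)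
Let near_min_diam (e : R) m n :
  near_min M x e m -> near_min M x e n -> rnorm (m - n) ^+ 2 < 4 * e.
Proof.
case=> Mm dm [Mn dn]; rewrite -/D -/d in dm dn.
pose v := x - 2^-1 *: (m + n).
have dv : d <= rnorm v ^+ 2 by apply: dist_min; apply: subspaceZ => //; apply: subspaceD.
have sumE : (x - n) + (x - m) = v + v.
  have half : 2^-1 + 2^-1 = 1 :> R[i] by field.
  by rewrite /v [RHS]addrACA -opprD -scalerDl half scale1r addrACA -opprD [n + m]addrC.
have diffE : (x - n) - (x - m) = m - n by rewrite opprB addrC addrA subrK.
have := parallelogram (x - n) (x - m); rewrite sumE diffE.
have := parallelogram v v; rewrite subrr.
have -> : rnorm (0 : H) = 0 by rewrite /rnorm normr0.
by rewrite expr0n /=; lra.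
Qed.

Let filter_near_min : ProperFilter (filter_from [set e | 0 < e] (near_min M x)).
Proof.
apply: filter_from_proper => //; apply: filter_from_filter.
  by exists 1; rewrite /=.
move=> e1 e2 /= e10 e20; exists (Num.min e1 e2); first by rewrite /= lt_min e10.
move=> m [Mm]; rewrite -/D -/d => dm.
by split; split=> //; apply: (lt_le_trans dm); rewrite lerD2l ge_min lexx ?orbT.
Qed.

(** Almost-nearest points form a Cauchy filter; its limit stays in M because M
    is closed, and it realizes the distance. *)
Lemma dist_minimizer : exists2 p, M p & forall m, M m -> rnorm (x - p) <= rnorm (x - m).
Proof.
pose F := filter_from [set e | 0 < e] (near_min M x).
have FF : ProperFilter F := filter_near_min.
have cF : cauchy F.
  apply: cauchy_exP => e e0.
  have r0 : 0 < complex.Re e by rewrite -ltcR RRe_real // gtr0_real.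
  have q0 : 0 < complex.Re e ^+ 2 / 4 by rewrite divr_gt0 // exprn_gt0.
  have [m xm] := near_min_neq0 q0.
  exists m; exists (complex.Re e ^+ 2 / 4) => // n xn.
  rewrite -ball_normE /= rnormE -[e]RRe_real ?gtr0_real // ltcR.
  rewrite -ltr_sqr ?nnegrE ?rnorm_ge0 //; last exact: ltW.
  by apply: lt_le_trans (near_min_diam xm xn) _; rewrite mulrC divfK.
have [p Fp] := (cvg_ex F).1 ((cauchy_cvgP F).1 cF).
have approx (e : R) : 0 < e -> exists2 m, near_min M x e m & rnorm (p - m) < e.
  move=> e0; have e0' : 0 < e%:C by rewrite ltcR.
  have Fb := Fp _ (nbhsx_ballx p _ e0').
  have Fm : F (near_min M x e) by exists e.
  have [m [xm]] := filter_ex (filterI Fm Fb).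
  by rewrite -ball_normE /= rnormE ltcR; exists m.
have Mp : M p.
  case: (cM) => _ _ /closed_rnormP; apply=> e /approx[m [Mm _] pm].
  by exists m.
exists p => // m /dist_min dm; rewrite -ler_sqr ?nnegrE ?rnorm_ge0 //.
apply: le_trans dm; rewrite leNgt; apply/negP => ds.
set s := rnorm (x - p) in ds.
have s0 : 0 <= s by exact: rnorm_ge0.
(* An almost-nearest point n within e of p gives s^2 < d + e (1 + 2 s); this
   value of e makes the right-hand side equal to s^2. *)
have e0 : 0 < (s ^+ 2 - d) / (1 + 2 * s) by apply: divr_gt0; lra.
have [n [Mn]] := approx _ e0; rewrite -/D -/d => dn pn.
have tri : s <= rnorm (x - n) + rnorm (p - n).
  by rewrite /s (rnormB p) -(subrKA n x (- p)) rnormD.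
have n0 := rnorm_ge0 (p - n); have a0 := rnorm_ge0 (x - n).
have eE : (s ^+ 2 - d) / (1 + 2 * s) * (1 + 2 * s) = s ^+ 2 - d.
  by rewrite divfK //; apply: lt0r_neq0; lra.
move: dn pn eE; set e := _ / _; set a := rnorm _ in tri a0 *; set b := rnorm _ in tri n0 *.
move=> dn pn eE.
have sb : s ^+ 2 - 2 * s * b <= a ^+ 2.
  by have [bs|sb] := leP b s; nra.
have se : s * b <= s * e by rewrite ler_wpM2l // ltW.
nra.
Qed.

End Minimizer.

(** If x - p were not orthogonal to some v in M, subtracting its component
    along v would give a point of M nearer to x than p. *)
Theorem projection_theorem M x :
  closed_subspace M -> exists2 p, M p & orthocomp M (x - p).
Proof.
move=> cM; have [p Mp pmin] := dist_minimizer cM x.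
exists p => // v Mv; apply: inner_eq0C.
have [->|/eqP v0] := eqVneq v 0; first by rewrite inner0r.
have vv_gt0 : 0 < ip v v by rewrite innerE exprn_gt0 // normr_gt0; apply/eqP.
have [_] := inner_residual (x - p) v0.
set t := _ / _; rewrite -addrA -opprD => rE.
have Mq : M (p + t *: v) by apply: subspaceD => //; apply: subspaceZ.
have : ip (x - p) (x - p) <= ip (x - (p + t *: v)) (x - (p + t *: v)).
  by rewrite !inner_rnorm lecR ler_sqr ?nnegrE ?rnorm_ge0 // pmin.
rewrite rE -subr_ge0 addrAC subrr add0r oppr_ge0 pmulr_lle0 ?invr_gt0 // => le0.
have : `|ip (x - p) v| ^+ 2 == 0 by rewrite eq_le le0 exprn_ge0.
by rewrite sqrf_eq0 normr_eq0 => /eqP.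
Qed.

End Projection.

(** * Bounded operators, closed spans and reducing subspaces *)

Lemma iter_commute (A : Type) (f g : A -> A) k x :
  (forall z, f (g z) = g (f z)) -> iter k f (g x) = g (iter k f x).
Proof. by move=> fg; elim: k => //= k ->. Qed.

Section Operators.
Context {R : realType} {H : hilbertSpace R}.
Implicit Types (x y z m : H) (M C : set H) (S T U V : boundedOp H).
Local Notation ip := (inner H).

Lemma op_rnorm_bound T :
  exists2 c : R, 0 <= c & forall x, rnorm (T x) <= c * rnorm x.
Proof.
have [M TM] := op_bounded T.
pose c := complex.Re `|M|.
have cE : `|M| = c%:C by rewrite RRe_real // ger0_real.
exists c; first by rewrite -ler0c -cE normr_ge0.
move=> x; rewrite -lecR rmorphM /= -!rnormE -cE.
have Mx : 0 <= M * `|x| by apply: le_trans (TM x).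
by rewrite -[X in _ * X]normr_id -normrM ger0_norm.
Qed.

Lemma bounded_opP (f : H -> H) :
  linear f -> (exists M : R[i], forall x, `|f x| <= M * `|x|) ->
  exists T, forall x, T x = f x.
Proof.
move=> lf bf; pose lin := GRing.isLinear.Build _ _ _ _ f lf.
by exists (@BoundedOp _ _ (HB.pack f lin : {linear H -> H}) bf).
Qed.

Definition id_op : boundedOp H.
Proof. by exists idfun; exists 1 => x; rewrite mul1r. Defined.

Definition comp_op S T : boundedOp H.
Proof.
exists (S \o T); have [a a0 Sa] := op_rnorm_bound S.
have [b b0 Tb] := op_rnorm_bound T.
exists (a * b)%:C => x; rewrite !rnormE -rmorphM lecR /=.
by apply: le_trans (Sa _) _; rewrite -mulrA ler_wpM2l.
Defined.

Definition comb_op (k : R[i]) S T : boundedOp H.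
Proof.
exists (k \*: S \+ T); have [a a0 Sa] := op_rnorm_bound S.
have [b b0 Tb] := op_rnorm_bound T.
exists (`|k| * a%:C + b%:C) => x /=.
apply: le_trans (ler_normD _ _) _; rewrite mulrDl -mulrA normrZ.
by apply: lerD; [apply: ler_wpM2l => //|]; rewrite !rnormE -rmorphM lecR.
Defined.

Lemma closed_subspace_preimage T C :
  closed_subspace C -> closed_subspace [set x | C (T x)].
Proof.
case=> C0 CD /closed_rnormP clC; split=> /=; first by rewrite linear0.
  by move=> a x y Cx Cy; rewrite linearP; apply: CD.
apply/closed_rnormP => x xC; apply: clC => e e0.
have [c c0 Tc] := op_rnorm_bound T.
have d0 : 0 < e / (c + 1) by apply: divr_gt0 => //; apply: ltr_wpDl.
have [m Cm xm] := xC _ d0; exists (T m) => //.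
rewrite -linearB; apply: le_lt_trans (Tc _) _.
have c1 : 0 < c + 1 by apply: ltr_wpDl.
apply: (@le_lt_trans _ _ ((c + 1) * rnorm (x - m))).
  by rewrite ler_wpM2r ?rnorm_ge0 // lerDl.
by rewrite mulrC -ltr_pdivlMr.
Qed.

(** Presents the zero subspace as an orthocomplement, so that its closedness,
    and that of kernels, comes from the closedness of orthocomplements. *)
Lemma orthocomp_setT : orthocomp setT = [set 0 : H].
Proof.
apply/seteqP; split=> [x xT|_ -> x _] /=; last exact: inner0r.
by apply: inner_eq0; apply: xT.
Qed.

Lemma closed_subspace_ker T : closed_subspace [set x | T x = 0].
Proof.
have := closed_subspace_preimage T (orthocomp_closed_subspace setT).
by rewrite orthocomp_setT.
Qed.

(** As an intersection rather than the closure of the linear span: a property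
    passes from A to its closed span as soon as the vectors that have it form a
    closed subspace, with no limit to take. *)
Definition closed_span (A : set H) : set H :=
  [set x | forall C, closed_subspace C -> A `<=` C -> C x].

Lemma closed_span_subspace A : closed_subspace (closed_span A).
Proof.
split=> [C [] //|a x y xA yA C cC AC|].
  by have [_ CD _] := cC; apply: CD; [apply: xA|apply: yA].
apply/closed_rnormP => x xA C cC AC.
have [_ _ /closed_rnormP] := cC; apply=> e /xA[m mA xm].
by exists m => //; apply: mA.
Qed.

Lemma sub_closed_span A : A `<=` closed_span A.
Proof. by move=> x Ax C _; apply. Qed.

Lemma closed_span_min A C : closed_subspace C -> A `<=` C -> closed_span A `<=` C.
Proof. by move=> cC AC x; apply. Qed.

Lemma closed_span_stable A T :
  (forall x, A x -> closed_span A (T x)) ->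
  forall x, closed_span A x -> closed_span A (T x).
Proof.
move=> AT; apply: closed_span_min => //.
exact/closed_subspace_preimage/closed_span_subspace.
Qed.

(** The orthocomplement of a single vector y is a closed subspace, so it
    contains the closed span as soon as it contains A. *)
Lemma orthocomp_closed_span A : orthocomp (closed_span A) = orthocomp A.
Proof.
apply/seteqP; split=> y yA x Ax; first by apply: yA; apply: sub_closed_span.
apply: inner_eq0C.
have AyC : closed_span A `<=` orthocomp [set y]; last exact: (AyC x Ax y).
apply: closed_span_min; first exact: orthocomp_closed_subspace.
by move=> a Aa _ ->; apply: inner_eq0C; apply: yA.
Qed.

(** The closed span of the union of all reducing subspaces inside the kernel is
    again one: invariance passes to closed spans, the orthocomplement of the
    union is an intersection of invariant subspaces, and ker S T is closed. *)
Lemma max_reducing_in_ker_exists S T : exists M, max_reducing_in_ker S T M.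
Proof.
pose A : set H := [set x | exists2 N, reducing_in_ker S T N & N x].
have redA W : (forall N, reducing_in_ker S T N -> reduces N W) ->
    reduces (closed_span A) W.
  move=> AW; split; first exact: closed_span_subspace.
    apply: closed_span_stable => x [N rN Nx]; apply: sub_closed_span.
    by exists N => //; case: (AW _ rN) => _ NW _; apply: NW.
  rewrite orthocomp_closed_span => y yA x [N rN Nx].
  case: (AW _ rN) => _ _ NW; apply: (NW y) => // z Nz.
  by apply: yA; exists N.
exists (closed_span A); split; last by move=> N rN x Nx; apply: sub_closed_span; exists N.
split; [by apply: redA => N []|by apply: redA => N []|].
apply: closed_span_min; first exact: (closed_subspace_ker (comp_op S T)).
by move=> x [N [_ _ NK]]; apply: NK.
Qed.

Lemma projection_opP M : closed_subspace M ->
  exists Q : boundedOp H, forall x, M (Q x) /\ orthocomp M (x - Q x).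
Proof.
move=> cM; have /choice[q qP] : forall x, exists p, M p /\ orthocomp M (x - p).
  by move=> x; have [p] := projection_theorem x cM; exists p.
have oM := orthocomp_closed_subspace M.
have uniq_q x p : M p -> orthocomp M (x - p) -> q x = p.
  move=> Mp xp; have [Mq xq] := qP x; apply/eqP; rewrite -subr_eq0.
  apply/eqP/inner_eq0; have := subspaceB oM xp xq.
  by rewrite opprB addrC addrA subrK; apply; apply: subspaceB.
have [||Q QE] := @bounded_opP q.
- move=> a x y; apply: uniq_q.
    apply: (subspaceD cM); last exact: (qP _).1.
    by apply: (subspaceZ _ cM); exact: (qP _).1.
  rewrite opprD addrACA -scalerBr.
  apply: (subspaceD oM); last exact: (qP _).2.
  by apply: (subspaceZ _ oM); exact: (qP _).2.
- exists 1 => x; rewrite mul1r !rnormE lecR -ler_sqr ?nnegrE ?rnorm_ge0 //.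
  have [Mq xq] := qP x; have := pythagoras (xq _ Mq).
  by rewrite addrC subrK => ->; rewrite lerDl sqr_ge0.
by exists Q => x; rewrite QE.
Qed.

Lemma orthogonal_decomposition M z : closed_subspace M ->
  exists x y, [/\ M x, orthocomp M y & z = x + y].
Proof.
move=> cM; have [p Mp zp] := projection_theorem z cM.
by exists p, (z - p); split=> //; rewrite addrC subrK.
Qed.

(** The operator Q + T (1 - Q), for Q the orthogonal projection onto M. *)
Lemma id_on_subspace_op M T : closed_subspace M ->
  exists W : boundedOp H,
    (forall x, M x -> W x = x) /\ (forall y, orthocomp M y -> W y = T y).
Proof.
move=> cM; have [Q QP] := projection_opP cM.
exists (comb_op 1 Q (comp_op T (comb_op (-1) Q id_op))) => /=.
have QE x : M x -> Q x = x.
  move=> Mx; have [MQ xQ] := QP x; apply/eqP; rewrite eq_sym -subr_eq0.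
  by apply/eqP/inner_eq0; apply: xQ; apply: subspaceB.
have Q0 y : orthocomp M y -> Q y = 0.
  move=> My; have [MQ yQ] := QP y; apply/inner_eq0.
  have := subspaceB (orthocomp_closed_subspace M) My yQ.
  by rewrite opprB addrC subrK; apply.
split=> x xM; rewrite scale1r scaleN1r.
  by rewrite QE // addNr linear0 addr0.
by rewrite Q0 // oppr0 !add0r.
Qed.

Lemma adjointC S T : is_adjoint S T -> is_adjoint T S.
Proof. by move=> ST x y; rewrite innerC -ST -innerC. Qed.

Lemma unitary_inverse U : unitary U ->
  exists V, [/\ unitary V, is_adjoint U V, forall x, V (U x) = x & forall x, U (V x) = x].
Proof.
case=> V [UV VU UVid]; exists V; split=> //.
by exists U; split=> //; apply: adjointC.
Qed.

Lemma unitary_inner U x y : unitary U -> ip (U x) (U y) = ip x y.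
Proof. by case/unitary_inverse => V [_ UV VU _]; rewrite UV VU. Qed.

Lemma unitary_inner_iter U k x y :
  unitary U -> ip (iter k U x) (iter k U y) = ip x y.
Proof. by move=> uU; elim: k => //= k IH; rewrite unitary_inner. Qed.

Lemma unitary_inj U : unitary U -> injective U.
Proof. by case/unitary_inverse => V [_ _ VU _]; apply: can_inj VU. Qed.

Lemma iter_opD k T x y : iter k T (x + y) = iter k T x + iter k T y.
Proof. by elim: k => //= k ->; rewrite linearD. Qed.

End Operators.

(** * Polynomials in an operator and spectra of operators of finite order *)

Section PolynomialCalculus.
Context {R : realType} {H : hilbertSpace R} (T : boundedOp H).
Implicit Types (x y : H) (p q : {poly R[i]}) (l z : R[i]).

(** The value p(T) x, as a sum of vectors because bounded operators carry no
    ring structure here. *)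
Definition poly_op p x : H := \sum_(i < size p) p`_i *: iter i T x.

Lemma poly_op_wide n p x : (size p <= n)%N ->
  poly_op p x = \sum_(i < n) p`_i *: iter i T x.
Proof.
move=> pn; rewrite /poly_op (big_ord_widen n (fun i => p`_i *: iter i T x) pn).
rewrite [RHS](bigID (fun i : 'I_n => (i < size p)%N)) /=.
rewrite [X in _ + X]big1 ?addr0 // => i; rewrite -leqNgt => ip.
by rewrite nth_default ?scale0r.
Qed.

Lemma poly_opD p q x : poly_op (p + q) x = poly_op p x + poly_op q x.
Proof.
pose n := maxn (size p) (size q).
rewrite (@poly_op_wide n (p + q)) ?size_polyD //.
rewrite (@poly_op_wide n p) ?leq_maxl // (@poly_op_wide n q) ?leq_maxr //.
by rewrite -big_split; apply: eq_bigr => i _; rewrite coefD scalerDl.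
Qed.

Lemma poly_opZ l p x : poly_op (l *: p) x = l *: poly_op p x.
Proof.
rewrite (@poly_op_wide (size p)) ?size_scale_leq // scaler_sumr.
by apply: eq_bigr => i _; rewrite coefZ scalerA.
Qed.

Lemma poly_opMX p x : poly_op (p * 'X) x = poly_op p (T x).
Proof.
rewrite (@poly_op_wide (size p).+1); last first.
  by rewrite (leq_trans (size_polyMleq _ _)) // size_polyX addnC.
rewrite big_ord_recl coefMX scale0r add0r; apply: eq_bigr => i _.
by rewrite coefMX /= -iterS iterSr.
Qed.

Lemma poly_opC l x : poly_op l%:P x = l *: x.
Proof.
by rewrite (@poly_op_wide 1) ?size_polyC_leq1 // big_ord1 coefC.
Qed.

Lemma poly_op_linear p : linear (poly_op p).
Proof.
have iter_linear i : linear (iter i T).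
  by elim: i => [|i IH] a x y //; rewrite !iterS (IH a x y) linearP.
move=> a x y; rewrite /poly_op scaler_sumr -big_split /=.
apply: eq_bigr => i _; rewrite iter_linear scalerDr !scalerA.
by rewrite [a * _]mulrC.
Qed.

Lemma poly_op_bounded p : exists W : boundedOp H, forall x, W x = poly_op p x.
Proof.
elim/poly_ind: p => [|p l [W WE]].
  by exists (comb_op (-1) id_op id_op) => x; rewrite poly_opC scale0r /= scaleN1r addNr.
exists (comb_op l id_op (comp_op W T)) => x /=.
by rewrite poly_opD poly_opMX poly_opC WE addrC.
Qed.

Lemma poly_op_commute p x : T (poly_op p x) = poly_op p (T x).
Proof.
rewrite /poly_op linear_sum; apply: eq_bigr => i _.
by rewrite linearZ_LR /= -iterS iterSr.
Qed.

Lemma poly_opM_XsubC p z x :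
  poly_op (p * ('X - z%:P)) x = T (poly_op p x) - z *: poly_op p x.
Proof.
rewrite mulrBr -mulrN -polyCN [p * _%:P]mulrC mul_polyC.
by rewrite poly_opD poly_opMX poly_opZ scaleNr poly_op_commute.
Qed.

Lemma poly_op_eigen p z x : T x = z *: x -> poly_op p x = p.[z] *: x.
Proof.
move=> Tx; elim/poly_ind: p => [|p l IH].
  by rewrite poly_opC horner0.
rewrite poly_opD poly_opMX -poly_op_commute IH poly_opC linearZ_LR Tx scalerA.
by rewrite -scalerDl !hornerE.
Qed.

(** If l is a root of p, then p = q (X - l), and injectivity of T - l shows that
    q annihilates T as well; induction on the size of p removes this case.
    Otherwise p = q (X - l) + p(l), so 0 = q(T) (T - l) + p(l), and
    - q(T) / p(l) is the inverse. *)
Lemma annihilated_resolvent p l :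
  p != 0 -> (forall x, poly_op p x = 0) -> (forall x, T x = l *: x -> x = 0) ->
  exists W : boundedOp H, forall x, W (T x - l *: x) = x /\ T (W x) - l *: W x = x.
Proof.
move=> + + injTl; have [n] := ubnP (size p); elim: n p => // n IH p pn p0 pT.
have [lp|lp] := boolP (root p l).
  have /factor_theorem[q qE] := lp.
  have q0 : q != 0 by apply: contra_neq p0 => q0; rewrite qE q0 mul0r.
  apply: (IH q _ q0) => [|x].
    by move: pn; rewrite qE size_Mmonic ?monicXsubC ?size_XsubC ?addn2.
  by apply: injTl; apply/eqP; rewrite -subr_eq0 -poly_opM_XsubC -qE pT.
have /factor_theorem[q qE] : root (p - p.[l]%:P) l.
  by rewrite rootE hornerD hornerN hornerC subrr.
have qT x : T (poly_op q x) - l *: poly_op q x = - p.[l] *: x.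
  by rewrite -poly_opM_XsubC -qE -polyCN poly_opD pT poly_opC add0r.
have qC x : poly_op q (T x - l *: x) = T (poly_op q x) - l *: poly_op q x.
  by rewrite addrC -scaleNr poly_op_linear poly_op_commute scaleNr addrC.
have [W WE] := poly_op_bounded (- p.[l]^-1 *: q).
have pl0 : - p.[l]^-1 * - p.[l] = 1 by rewrite mulrNN mulVf.
exists W => x; rewrite !WE !poly_opZ; split.
  by rewrite qC qT scalerA pl0 scale1r.
by rewrite linearZ_LR scalerA [l * _]mulrC -scalerA -scalerBr qT scalerA pl0 scale1r.
Qed.

(** Let q be the product of the factors other than X - z.  Then y = q(T) x is
    an eigenvector for z or zero, and q(T) y = q(z) y with q(z) <> 0, the roots
    being distinct.  Hence q(T) kills x - y / q(z), to which induction
    applies. *)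
Lemma annihilated_in_eigenspan (s : seq R[i]) (M : set H) x :
  uniq s -> closed_subspace M -> (forall l y, eigenvector T l y -> M y) ->
  poly_op (\prod_(z <- s) ('X - z%:P)) x = 0 -> M x.
Proof.
move=> + cM eM; elim: s x => [x _|z s IH x].
  by rewrite big_nil -polyC1 poly_opC scale1r => ->; case: cM.
rewrite big_cons mulrC => /andP[zs us]; set q := \prod_(z <- s) _.
rewrite poly_opM_XsubC => /eqP; rewrite subr_eq0 => /eqP eqx.
have My : M (poly_op q x).
  have [->|/eqP y0] := eqVneq (poly_op q x) 0; first by case: cM.
  exact: (eM z).
have qz : q.[z] != 0 by rewrite -rootE root_prod_XsubC.
rewrite -[x](subrK (q.[z]^-1 *: poly_op q x)).
apply: (subspaceD cM); last exact: (subspaceZ _ cM).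
apply: IH => //; rewrite -/q -scaleNr addrC poly_op_linear.
by rewrite (poly_op_eigen _ eqx) scalerA mulNr mulVf // scaleN1r addNr.
Qed.

End PolynomialCalculus.

Section FiniteOrder.
Context {R : realType} {H : hilbertSpace R}.

Lemma Xn_sub_1_split (m : nat) : (0 < m)%N ->
  exists2 s : seq R[i], uniq s & 'X^m - 1 = \prod_(z <- s) ('X - z%:P).
Proof.
move=> m0; have [s sE] := closed_field_poly_normal ('X^m - 1 : {poly R[i]}).
have mon : 'X^m - 1 \is @monic R[i] by rewrite monicXnsubC.
move: sE; rewrite (monicP mon) scale1r => sE; exists s => //.
by rewrite -separable_prod_XsubC -sE separable_Xn_sub_1 // pnatr_eq0 -lt0n.
Qed.

Lemma finite_order_spectrum (T : boundedOp H) (m : nat) :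
  (0 < m)%N -> iter m T =1 id ->
  pure_point_spectrum T /\ forall l, spectrum T l -> l ^+ m = 1.
Proof.
move=> m0 Tm.
have annT x : poly_op T ('X^m - 1) x = 0.
  rewrite poly_opD -polyC1 -polyCN poly_opC scaleN1r.
  apply/eqP; rewrite subr_eq0; apply/eqP; rewrite -[RHS]Tm.
  have -> n : poly_op T 'X^n x = iter n T x.
    by elim: n x => [|n IH] x; rewrite ?expr0 -?polyC1 ?poly_opC ?scale1r // exprSr poly_opMX IH -iterSr.
  by [].
have Xm0 : 'X^m - 1 != 0 :> {poly R[i]} by rewrite monic_neq0 // monicXnsubC.
have specE : spectrum T = point_spectrum T.
  apply/seteqP; split=> l.
    move=> /= sl; apply: contrapT => nl; apply: sl.
    apply: (annihilated_resolvent Xm0 annT) => x Tx; apply: contrapT => x0.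
    by apply: nl; exists x.
  move=> [x [x0 Tx]] [W WE]; apply: x0.
  by have [<- _] := WE x; rewrite Tx subrr linear0.
split; last first.
  rewrite specE => l [x [/eqP x0 Tx]].
  have := annT x; rewrite (poly_op_eigen _ Tx) !hornerE => /eqP.
  by rewrite scaler_eq0 (negPf x0) orbF subr_eq0 => /eqP.
split=> // M cM eM; apply/seteqP; split=> // x _.
have [s us sE] := Xn_sub_1_split m0.
by apply: (annihilated_in_eigenspan us cM eM); rewrite -sE annT.
Qed.

End FiniteOrder.

(** * Twists of pairs with a potent member *)

Section Twist.
Context {R : realType} {H : hilbertSpace R}.
Implicit Types (x y : H) (M N : set H) (U V P S T : boundedOp H).
Local Notation ip := (inner H).

Definition commuting S T := forall x, S (T x) = T (S x).

Lemma commuting_inverse U V T :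
  (forall x, V (U x) = x) -> (forall x, U (V x) = x) ->
  commuting U T -> commuting V T.
Proof. by move=> VU UV UT x; rewrite -{1}[x]UV -UT VU. Qed.

Lemma twist_iter U P S k x :
  is_twist U P S -> iter k P (S x) = iter k U (S (iter k P x)).
Proof.
case=> _ UP _ PS; elim: k => //= k ->.
rewrite -(@iter_commute _ U P) // [P (S _)]PS /=.
by rewrite iter_commute.
Qed.

(** By [twist_iter] for k = n, P S = U^n S P; one factor U turns S P back into
    P S. *)
Lemma npotent_twist_fixes n U P S x :
  (0 < n)%N -> is_twist U P S -> n_potent n P ->
  iter n.-1 U (P (S x)) = P (S x).
Proof.
case: n => // n _ tw Pn; have [_ _ _ PS] := tw.
have := twist_iter n.+1 x tw; rewrite !Pn iterSr /= => {2}->.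
by rewrite [P (S x)]PS.
Qed.

(** The image of M under U, described as the preimage of M under the inverse of
    U, is again a reducing subspace inside the kernel, so maximality puts it
    in M. *)
Lemma max_reducing_stable U P S M :
  unitary U -> commuting U P -> commuting U S ->
  max_reducing_in_ker P S M -> forall x, M x -> M (U x).
Proof.
move=> uU UP US [[rP rS MK] Mmax].
have [V [uV UadjV VU UV]] := unitary_inverse uU.
have [cM _ _] := rP.
pose N := [set x | M (V x)].
have orthoN y : orthocomp N y <-> orthocomp M (V y).
  split=> yN x Mx; first by rewrite -UadjV; apply: yN; rewrite /N /= VU.
  by rewrite -(unitary_inner _ _ uV); apply: yN.
have redN T : commuting U T -> reduces M T -> reduces N T.
  move=> /(commuting_inverse VU UV) VT [_ MT oMT]; split.
  - exact: closed_subspace_preimage.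
  - by move=> x Nx; rewrite /N /= VT; apply: MT.
  - by move=> y /orthoN yM; apply/orthoN; rewrite VT; apply: oMT.
suff NM : N `<=` M by move=> x Mx; apply: NM; rewrite /N /= VU.
apply: Mmax; split; [exact: redN|exact: redN|move=> x Nx].
rewrite -[x]UV -US -UP MK // linear0 //.
Qed.

(** The inverse of U also preserves M and is the adjoint of U, so U preserves
    the orthocomplement. *)
Lemma max_reducing_reduces U P S M :
  unitary U -> commuting U P -> commuting U S ->
  max_reducing_in_ker P S M -> reduces M U.
Proof.
move=> uU UP US maxM; have [V [uV UadjV VU UV]] := unitary_inverse uU.
have VM := max_reducing_stable uV (commuting_inverse VU UV UP)
  (commuting_inverse VU UV US) maxM.
split; [by case: maxM => -[[]]|exact: max_reducing_stable maxM|].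
by move=> y yM x Mx; rewrite -(adjointC UadjV); apply/yM/VM.
Qed.

(** With W the k-th power of U, the closed span of the range of W - 1 is a
    reducing subspace inside ker P S, and its orthocomplement is the fixed
    space of W. *)
Lemma fixes_range_fixes_orthocomp k U P S M y :
  unitary U -> commuting U P -> commuting U S ->
  (forall x, iter k U (P (S x)) = P (S x)) ->
  max_reducing_in_ker P S M -> orthocomp M y -> iter k U y = y.
Proof.
move=> uU UP US fixPS [_ Mmax] yM.
pose A := [set iter k U x - x | x in setT].
have orthoA z : orthocomp A z <-> iter k U z = z.
  split=> [zA|Uz _ [x _ <-]]; last first.
    by rewrite innerBl -{1}Uz unitary_inner_iter // subrr.
  (* Orthogonality to W z - z alone suffices: expanding the square norm of
     W z - z, every term is the square norm of z. *)
  have Uzz : ip (iter k U z) z = ip z z.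
    by apply/eqP; rewrite -subr_eq0 -innerBl; apply/eqP/zA; exists z.
  apply/eqP; rewrite -subr_eq0; apply/eqP/inner_eq0.
  rewrite innerBl !innerBr unitary_inner_iter // Uzz [ip z (iter _ _ _)]innerC.
  by rewrite Uzz -innerC subrr.
have redN T : commuting U T -> reduces (closed_span A) T.
  move=> UT; split; first exact: closed_span_subspace.
    apply: closed_span_stable => _ [x _ <-]; apply: sub_closed_span.
    by exists (T x) => //; rewrite linearB iter_commute.
  rewrite orthocomp_closed_span => z /orthoA Uz; apply/orthoA.
  by rewrite iter_commute // Uz.
have NM : closed_span A `<=` M.
  apply: Mmax; split; [exact: redN|exact: redN|].
  apply: closed_span_min; first exact: (closed_subspace_ker (comp_op P S)).
  move=> _ [x _ <-] /=; rewrite !linearB.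
  rewrite -(@iter_commute _ U S) // -(@iter_commute _ U P) //.
  by rewrite fixPS subrr.
by apply/orthoA => x Ax; apply: yM; apply: NM; apply: sub_closed_span.
Qed.

(** On M, P S = 0, and injectivity of U turns U S P = P S into S P = 0, so the
    twist relation holds there whatever replaces U; on the orthocomplement U is
    kept and its k-th power is already the identity. *)
Lemma id_on_max_reducing_twist k U P S M :
  is_twist U P S -> (forall x, iter k U (P (S x)) = P (S x)) ->
  max_reducing_in_ker P S M ->
  exists W : boundedOp H,
    [/\ forall x, M x -> W x = x, forall y, orthocomp M y -> W y = U y,
        is_twist W P S & iter k W =1 id].
Proof.
move=> [uU UP US PS] fixPS maxM.
have [[rP rS MK] _] := maxM; have [cM _ _] := rP.
have [V [uV UadjV VU UV]] := unitary_inverse uU.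
have rU := max_reducing_reduces uU UP US maxM.
have rV := max_reducing_reduces uV (commuting_inverse VU UV UP)
  (commuting_inverse VU UV US) maxM.
have [W [WM WoM]] := id_on_subspace_op U cM.
have [W' [WM' WoM']] := id_on_subspace_op V cM.
exists W; split=> //.
  have WT T : commuting U T -> reduces M T -> commuting W T.
    move=> UT [_ MT oMT] x; have [a [b [Ma Mb ->]]] := orthogonal_decomposition x cM.
    have MTa := MT a Ma; have oTb := oMT b Mb.
    by rewrite !linearD (WM a) // (WM (T a)) // (WoM b) // (WoM (T b)) // UT.
  split; [|exact: WT|exact: WT|].
    exists W'; split.
    - move=> x y.
      have [a [b [Ma Mb ->]]] := orthogonal_decomposition x cM.
      have [c [d [Mc Md ->]]] := orthogonal_decomposition y cM.
      rewrite [W (a + b)]linearD [W' (c + d)]linearD !innerDl !innerDr WM // WoM // WM' // WoM' // (UadjV b d).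
      have [_ _ oU] := rU; have [_ _ oV] := rV.
      rewrite (Md a Ma) (oV d Md a Ma).
      by rewrite [ip (U b) c]innerC (oU b Mb c Mc) [ip b c]innerC (Mb c Mc).
    - move=> x; have [a [b [Ma Mb ->]]] := orthogonal_decomposition x cM.
      have [_ _ oU] := rU.
      by rewrite /= !linearD WM // WoM // WM' // WoM' ?VU //; apply: oU.
    - move=> x; have [a [b [Ma Mb ->]]] := orthogonal_decomposition x cM.
      have [_ _ oV] := rV.
      by rewrite /= !linearD WM' // WoM' // WM // WoM ?UV //; apply: oV.
  move=> x; have [a [b [Ma Mb ->]]] := orthogonal_decomposition x cM.
  have SPa : S (P a) = 0.
    by apply: (unitary_inj uU); rewrite linear0; have /= <- := PS a; apply: MK.
  rewrite /= !linearD MK // SPa linear0 WoM; first by rewrite [P (S b)]PS.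
  by have [_ _ oS] := rS; have [_ _ oP] := rP; apply/oS/oP.
move=> x; have [a [b [Ma Mb ->]]] := orthogonal_decomposition x cM.
rewrite iter_opD; congr (_ + _); first by elim: (k) => //= i ->; apply: WM.
rewrite -[RHS](fixes_range_fixes_orthocomp uU UP US fixPS maxM Mb).
have [_ _ oU] := rU.
have oUi i : orthocomp M (iter i U b) by elim: i => //= i; apply: oU.
by elim: (k) => //= i ->; apply: WoM.
Qed.

(** A 0 + B 0 = T 0 = 0 puts A 0 both in M and in its orthocomplement, whence
    A 0 = 0. *)
Lemma direct_sum_op_snd M (A B : H -> H) T y : closed_subspace M ->
  direct_sum_op M A B T -> orthocomp M y -> B y = T y.
Proof.
move=> cM [MA MB AB] yM; have [M0 _ _] := cM.
have o0 : orthocomp M 0 by move=> x _; apply: inner0r.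
have A0 : A 0 = 0.
  have := AB 0 0 M0 o0; rewrite addr0 linear0 => /esym/eqP.
  rewrite addrC addr_eq0 => /eqP B0; have := MB 0 o0 (A 0) (MA 0 M0).
  by rewrite B0 innerNr => /eqP; rewrite oppr_eq0 => /eqP/inner_eq0.
by have := AB 0 y M0 yM; rewrite A0 !add0r.
Qed.

(** U P S = P S = U S P, and U is injective. *)
Lemma idempotent_twist_commute P S :
  n_potent 2 P -> twisted_commuting P S -> P \o S =1 S \o P.
Proof.
move=> P2 [U tw] x; have [uU _ _ PS] := tw; apply: (unitary_inj uU).
have /= -> := @npotent_twist_fixes 2 U P S x isT tw P2.
by rewrite -[RHS]PS.
Qed.

(** The inverse of a twist is a twist of the swapped pair. *)
Lemma twisted_commutingC S T : twisted_commuting S T -> twisted_commuting T S.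
Proof.
case=> U [uU US UT ST]; have [V [uV _ VU UV]] := unitary_inverse uU.
exists V; split=> //; try exact: commuting_inverse VU UV _.
by move=> x /=; have /= -> := ST x; rewrite VU.
Qed.

(** The hypotheses on e mean that e is 1 or -1.  For y orthogonal to the
    eigenspace of e, the vector y + e U y lies in that eigenspace and is
    orthogonal to itself. *)
Lemma involution_eigenspace_orthocomp U (e : R[i]) :
  unitary U -> iter 2 U =1 id -> e^* = e -> e * e = 1 ->
  orthocomp [set x | U x = e *: x] = [set x | U x = - e *: x].
Proof.
move=> uU UU eJ ee; apply/seteqP; split=> y /= yE.
  pose z := y + e *: U y.
  have UUy : U (U y) = y := UU y.
  have Uz : U z = e *: z.
    by rewrite linearD linearZ_LR UUy scalerDr scalerA ee scale1r addrC.
  have zy : ip z y = 0 by apply: yE.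
  have : z = 0.
    apply: inner_eq0; rewrite {2}/z innerDr zy innerZr add0r.
    by rewrite -(unitary_inner z _ uU) UUy Uz innerZl zy !mulr0.
  rewrite scaleNr => /(congr1 (fun t => e *: t)); rewrite scaler0 scalerDr.
  by rewrite scalerA ee scale1r addrC => /eqP; rewrite addr_eq0 => /eqP.
move=> x /= xE; have : ip x y = - ip x y.
  rewrite -{1}(unitary_inner x y uU) xE yE innerZl innerZr rmorphN /= eJ.
  by rewrite mulrA mulrN ee mulN1r.
by move/eqP; rewrite -addr_eq0 -mulr2n mulrn_eq0 /= => /eqP.
Qed.

Lemma involution_eigenspace_reduces U T (e : R[i]) :
  unitary U -> iter 2 U =1 id -> e^* = e -> e * e = 1 -> commuting U T ->
  reduces [set x | U x = e *: x] T.
Proof.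
move=> uU UU eJ ee UT; split.
- have := closed_subspace_ker (comb_op (- e) id_op U); congr closed_subspace.
  apply/seteqP; split=> x /=; rewrite scaleNr addrC.
    by move/eqP; rewrite subr_eq0 => /eqP.
  by move=> ->; rewrite subrr.
- by move=> x /= Ux; rewrite UT Ux linearZ_LR.
- by rewrite involution_eigenspace_orthocomp // => y /= Uy; rewrite UT Uy linearZ_LR.
Qed.

End Twist.

(** * Structure of twisted commuting pairs with a potent member *)

Theorem mainTheorem3 (R : realType) (H : hilbertSpace R) :
  (* (a) and (b) *)
  (forall (n : nat) (U P S : boundedOp H),
     (2 <= n)%N -> is_twist U P S -> n_potent n P ->
     P \o S =1 iter n.-1 U \o P \o S /\
     (exists H0 : set H, max_reducing_in_ker P S H0) /\
     (forall H0 : set H, max_reducing_in_ker P S H0 ->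
        reduces H0 U /\
        (forall U0 U1 : H -> H, direct_sum_op H0 U0 U1 U ->
           (forall y, orthocomp H0 y -> iter n.-1 U1 y = y) /\
           (exists Ut : boundedOp H,
              [/\ direct_sum_op H0 id U1 Ut,
                  is_twist Ut P S,
                  iter n.-1 Ut =1 id,
                  pure_point_spectrum Ut &
                  forall l, spectrum Ut l -> l ^+ n.-1 = 1])))) /\
  (* (c) *)
  (forall P S : boundedOp H,
     n_potent 2 P -> twisted_commuting P S -> P \o S =1 S \o P) /\
  (forall Q T : boundedOp H,
     orthogonal_projection Q ->
     twisted_commuting Q T \/ twisted_commuting T Q -> Q \o T =1 T \o Q) /\
  (* (d) *)
  (forall P S : boundedOp H,
     n_potent 3 P -> twisted_commuting P S ->
     exists M N : set H,
       [/\ orthogonal_sum M N,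
           reduces M P /\ reduces M S,
           reduces N P /\ reduces N S,
           forall x, M x -> P (S x) = S (P x) &
           forall x, N x -> P (S x) = - S (P x)]).
Proof.
split.
  move=> n U P S n2 tw Pn; have n1 : (0 < n.-1)%N by case: n n2 {Pn} => [|[]].
  have fixPS x : iter n.-1 U (P (S x)) = P (S x).
    by apply: npotent_twist_fixes Pn => //; apply: ltnW.
  split; first by move=> x; rewrite /= fixPS.
  split; first exact: max_reducing_in_ker_exists.
  move=> M maxM; have [uU UP US _] := tw; have [[[cM _ _] _ _] _] := maxM.
  split; first exact: max_reducing_reduces maxM.
  move=> U0 U1 dU; have U1E y := direct_sum_op_snd cM dU (y := y).
  have [_ U1M _] := dU.
  split=> [y yM|].
    rewrite -[RHS](fixes_range_fixes_orthocomp uU UP US fixPS maxM yM).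
    suff [] : iter n.-1 U1 y = iter n.-1 U y /\ orthocomp M (iter n.-1 U1 y) by [].
    elim: (n.-1) => //= i [IH iM]; split; last exact: U1M.
    by rewrite U1E // IH.
  have [W [WM WoM tW Wn]] := id_on_max_reducing_twist tw fixPS maxM.
  have [ppW specW] := finite_order_spectrum n1 Wn.
  exists W; split=> //; split=> // x y Mx My.
  by rewrite linearD WM // WoM // U1E.
split; first exact: idempotent_twist_commute.
split.
  move=> Q T [QQ _] QT; apply: idempotent_twist_commute => //.
  by case: QT => // /twisted_commutingC.
move=> P S P3 [U tw].
have fixPS x : iter 2 U (P (S x)) = P (S x) by apply: (npotent_twist_fixes (n := 3)).
have [M maxM] := max_reducing_in_ker_exists P S.
have [W [_ _ [uW WP WS PS] W2]] := id_on_max_reducing_twist tw fixPS maxM.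
have cWP : commuting W P := WP; have cWS : commuting W S := WS.
have WWx x : W (W x) = x := W2 x.
have J1 : (1 : R[i])^* = 1 := rmorph1 _.
have JN1 : (-1 : R[i])^* = -1 by rewrite rmorphN1.
(* Each z is the sum of (z + W z) / 2 and (z - W z) / 2. *)
exists [set x | W x = 1 *: x], [set x | W x = -1 *: x]; split.
- split.
    move=> x y Wx Wy.
    have := involution_eigenspace_orthocomp uW W2 J1 (mulr1 1).
    by move=> /seteqP[_ /(_ y Wy x Wx)].
  move=> z; exists (2^-1 *: (z + W z)), (2^-1 *: (z - W z)); split=> /=.
  + by rewrite linearZ_LR linearD WWx scale1r addrC.
  + by rewrite linearZ_LR linearB WWx scaleN1r -scalerN opprB.
  + rewrite -scalerDr addrACA subrr addr0 -[z + z]mulr2n -[z *+ 2]scaler_nat scalerA.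
    by rewrite mulVf ?scale1r // pnatr_eq0.
- split; apply: involution_eigenspace_reduces => //; exact: mulr1.
- split; apply: involution_eigenspace_reduces => //; by rewrite mulrNN mulr1.
- move=> x /= Wx; have /= -> := PS x.
  by rewrite cWS cWP Wx scale1r.
- move=> x /= Wx; have /= -> := PS x.
  by rewrite cWS cWP Wx !linearZ_LR scaleN1r.
Qed.
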